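(* For all integers $m\ge 0$ and $n\ge 0$, $$u(m,n)\ge u(m+1,n).$$ Moreover, for every integer $m\ge 0$ and every integer $n\ge \max\{6,\binom{m+2}{2}\}$, $$u(m,n)> u(m+1,n).$$
   Context: A strongly unimodal sequence of weight $n$ is a finite sequence of positive integers $(a_1,\ldots,a_\ell)$ such that, for some $k$ with $1\le k\le \ell$, $$a_1<a_2<\cdots<a_{k-1}<a_k>a_{k+1}>\cdots>a_\ell\ge 1,$$ and $\sum_{i=1}^{\ell}a_i=n$. The index $k$ is the peak position. The rank of such a sequence is $\ell-2k+1$, that is, the number of terms after the maximum term minus the number of terms before it. For integers $m$ and $n\ge 0$, $u(m,n)$ denotes the number of strongly unimodal sequences of weight $n$ and rank $m$. *)

(* Defs.v *)
From HB Require Import structures.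
From mathcomp Require Import all_boot all_order all_algebra.

Set Implicit Arguments.
Unset Strict Implicit.
Unset Printing Implicit Defensive.

Import Order.TTheory GRing.Theory Num.Theory.

(* For s = (a_1, ..., a_l), [is_peak s k] says that 1 <= k <= l and
   a_1 < ... < a_k > ... > a_l.  The index k is 1-based, so [take k s] is
   (a_1, ..., a_k) and [drop k.-1 s] is (a_k, ..., a_l). *)
Definition is_peak (s : seq nat) (k : nat) : bool :=
  [&& 1 <= k <= size s, sorted ltn (take k s) & sorted gtn (drop k.-1 s)].

Definition strongly_unimodal (s : seq nat) : bool :=
  all (ltn 0) s && has (is_peak s) (iota 1 (size s)).

(* Since [iota 0 _] enumerates 0, 1, 2, ..., [find] returns the peak position
   itself.  It is meaningful only when a peak exists. *)
Definition peak (s : seq nat) : nat := find (is_peak s) (iota 0 (size s).+1).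

Definition rank (s : seq nat) : int :=
  ((size s)%:Z - 2 * (peak s)%:Z + 1)%R.

Definition su_pred (m : int) (n : nat) (s : seq nat) : bool :=
  [&& strongly_unimodal s, sumn s == n & rank s == m].

(* A sequence of positive integers of sum n has at most n terms, all at most n,
   so it is enough to count sequences of length <= n with values in 'I_n.+1;
   see [uE]. *)
Definition u (m : int) (n : nat) : nat :=
  #|[set s : n.-bseq 'I_n.+1 | su_pred m n [seq val i | i <- s]]|.

Lemma is_peak_uniq s j k : is_peak s j -> is_peak s k -> j = k.
Proof.
wlog lt_jk : j k / j < k => [hw | ].
  case: (ltngtP j k) => // h pj pk; first exact: hw.
  by apply: esym; apply: hw.
move=> /and3P[/andP[j0 js] _ dj] /and3P[/andP[k0 ks] ik _].
have lt_jS : j < size s by apply: leq_trans ks.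
have h1 : nth 0 s j.-1 < nth 0 s j.
  have /(_ j.-1) := elimT (sortedP 0) ik; rewrite size_takel // prednK //.
  by rewrite !nth_take // ?(leq_ltn_trans (leq_pred j)) //; apply.
have h2 : nth 0 s j < nth 0 s j.-1.
  have /(_ 0) := elimT (sortedP 0) dj.
  rewrite size_drop !nth_drop addn0 addn1 prednK //; apply.
  by rewrite ltn_subRL addn1 prednK.
by move: (ltn_trans h1 h2); rewrite ltnn.
Qed.

Lemma peakE s k : is_peak s k -> peak s = k.
Proof.
move=> pk; have ks : k <= size s by case/and3P: pk => /andP[].
have hs : has (is_peak s) (iota 0 (size s).+1).
  by apply/hasP; exists k => //; rewrite mem_iota.
apply: (@is_peak_uniq s) => //.
have := nth_find 0 hs; rewrite nth_iota ?add0n //.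
by move: hs; rewrite has_find size_iota.
Qed.

Lemma rankE s k : is_peak s k -> rank s = ((size s)%:Z - 2 * k%:Z + 1)%R.
Proof. by move=> /peakE pk; rewrite /rank pk. Qed.

Lemma uE m n (L : seq (seq nat)) :
  uniq L -> (forall s, (s \in L) = su_pred m n s) -> u m n = size L.
Proof.
move=> uL memL; rewrite /u cardE.
set A := enum _; pose f (t : n.-bseq 'I_n.+1) := [seq val i | i <- t].
have fI : injective f by move=> t1 t2 /(inj_map val_inj) /val_inj.
rewrite -(size_map f); apply: perm_size; apply: uniq_perm => //.
  by rewrite (map_inj_uniq fI) enum_uniq.
move=> s; rewrite memL; apply/mapP/idP => [[t]|ps].
  by rewrite mem_enum inE => h ->.
have /and3P[/andP[pos _] /eqP sn _] := ps.
have le_s : all (fun a => a <= n) s.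
  apply/allP => a /[dup] as_ /perm_to_rem /perm_sumn e.
  by rewrite -sn e /= leq_addr.
have sz : size s <= n.
  rewrite -sn; elim: s pos {ps sn le_s} => //= a s IH /andP[a0 /IH h].
  by rewrite -add1n leq_add.
have szm : size [seq inord i : 'I_n.+1 | i <- s] <= n by rewrite size_map.
have e : f (Bseq szm) = s.
  rewrite /f /= -map_comp -[RHS]map_id; apply/eq_in_map => a /(allP le_s) an /=.
  by rewrite inordK.
by exists (Bseq szm); rewrite // mem_enum inE -/(f _) e.
Qed.

(* Main.v *)
(* Let A and B be the sets of terms before and after the peak p, so that the
   rank is |B| - |A| and p = n - (sum A) - (sum B) is determined by A and B.
   Rank m+1 injects into rank m >= 0 as follows.  If 1 \in B, remove 1 from B; the
   peak grows by 1.  Otherwise, use the reflection principle on the two walks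
   #(A :&: [1, j]) and #((B - 1) :&: [1, j]): the second ends above the first,
   so let j be the first time that it is one ahead, exchange the two sets up to
   j and put 1 in B.  The exchange lowers the sum by 1, which the new term 1
   compensates.  The two cases are told apart in the image by whether 1 \in B.

   The image contains no (A, B) with A empty and 1 \in B, and none with
   1 \notin B and p - 1 \in B; this yields strictness. *)
Require Import Defs.
From mathcomp Require Import all_boot all_order all_algebra.
From mathcomp Require Import zify.

Set Implicit Arguments.
Unset Strict Implicit.
Unset Printing Implicit Defensive.

(** * Finite sets of integers as bit masks *)

(* [m] is the indicator of [sel i m] on the interval starting at [i]. *)
Definition sel (i : nat) (m : bitseq) : seq nat := mask m (iota i (size m)).

Lemma sel_cons i b m : sel i (b :: m) = nseq b i ++ sel i.+1 m.
Proof. by case: b. Qed.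

Lemma sorted_sel i m : sorted ltn (sel i m).
Proof. exact: (sorted_mask ltn_trans _ (iota_ltn_sorted _ _)). Qed.

Lemma sel_ge i m x : x \in sel i m -> i <= x.
Proof. by move/mem_mask; rewrite mem_iota => /andP[]. Qed.

Lemma size_sel i m : size (sel i m) = count id m.
Proof. by rewrite size_mask // size_iota. Qed.

Lemma sel_inj i m1 m2 : size m1 = size m2 -> sel i m1 = sel i m2 -> m1 = m2.
Proof.
elim: m1 m2 i => [|b1 m1 IH] [|b2 m2] //= i [e].
rewrite !sel_cons; case: b1; case: b2 => //= h.
- by case: h => /(IH _ _ e) ->.
- have : i \in sel i.+1 m2 by rewrite -h mem_head.
  by move/sel_ge; rewrite ltnn.
- have : i \in sel i.+1 m1 by rewrite h mem_head.
  by move/sel_ge; rewrite ltnn.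
- by rewrite (IH _ _ e h).
Qed.

Lemma sel_mem i k s : sorted ltn s -> all (fun x => i <= x < i + k) s ->
  sel i [seq x \in s | x <- iota i k] = s.
Proof.
move=> ss /allP bs; rewrite /sel size_map size_iota -filter_mask.
apply: (irr_sorted_eq ltn_trans ltnn) => //.
  exact: sorted_filter ltn_trans _ _ (iota_ltn_sorted _ _).
move=> x; rewrite mem_filter mem_iota.
by case xs: (x \in s) => //=; rewrite bs.
Qed.

(** * Reflection of a pair of walks *)

(* [d] is the current lead of the first walk over the second. *)
Fixpoint reflect_prefix (d : nat) (s : seq (bool * bool)) :=
  if s is (a, b) :: s' then
    (b, a) :: (if [&& b, ~~ a & d == 0] then s'
               else reflect_prefix (d + a - b) s')
  else [::].

Lemma size_reflect_prefix d s : size (reflect_prefix d s) = size s.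
Proof. by elim: s d => //= -[a b] s IH d /=; case: ifP => // _; rewrite IH. Qed.

(** Up to the stop the output shows the input pairs swapped, so the stopping test can be replayed
    from it. *)
Lemma reflect_prefix_inj d : injective (reflect_prefix d).
Proof.
move=> s; elim: s d => [|[a b] s IH] d [|[a' b'] t] //= [-> ->].
by case: ifP => _ => [->|/IH ->].
Qed.

(** The hypothesis forces the second walk to get one ahead; the prefix exchanged by then has [d.+1]
    more elements in the second set than in the first. *)
Lemma size_reflect_prefix_sel s d i :
  size (sel i (unzip1 s)) + d < size (sel i.+1 (unzip2 s)) ->
  size (sel i (unzip1 (reflect_prefix d s))) =
    size (sel i (unzip1 s)) + d.+1 /\
  size (sel i.+1 (unzip2 (reflect_prefix d s))) + d.+1 =
    size (sel i.+1 (unzip2 s)).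
Proof.
rewrite !size_sel; elim: s d => //= -[a b] t IH e.
(* This subtraction truncates only in the stopping case. *)
have := IH (e + a - b).
by case: a; case: b => /=; case: (e =P 0) => [->|ne0] /=; lia.
Qed.

(** A bit at position [i] means [i] in the first set but [i.+1] in the second, so each exchanged
    element moves by one; [d.+1] more of them move down than up. *)
Lemma sumn_reflect_prefix s d i :
  size (sel i (unzip1 s)) + d < size (sel i.+1 (unzip2 s)) ->
  sumn (sel i (unzip1 (reflect_prefix d s))) +
  sumn (sel i.+1 (unzip2 (reflect_prefix d s))) + d.+1 =
  sumn (sel i (unzip1 s)) + sumn (sel i.+1 (unzip2 s)).
Proof.
rewrite !size_sel; elim: s d i => // -[a b] t IH e i.
rewrite [reflect_prefix _ _]/=; set r := if _ then _ else _.
rewrite /= !sel_cons !sumn_cat /r; have := IH (e + a - b) i.+1.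
by case: a {r}; case: b; case: (e =P 0) => [->|ne0]; rewrite ?addn0 /=; lia.
Qed.

Lemma excess_bound s d i k :
  size (sel i (unzip1 s)) + d < size (sel i.+1 (unzip2 s)) ->
  all (leq^~ k) (sel i.+1 (unzip2 s)) -> i < k.
Proof.
move=> h; case E: (sel _ (unzip2 s)) h => [|x l] h /=; first by rewrite ltn0 in h.
case/andP => xk _; apply: leq_trans xk.
by apply: (@sel_ge _ (unzip2 s)); rewrite E mem_head.
Qed.

(** Only a move from [i] up to [i.+1] could break the bound. Until the stop the second set still has
    an element at least [i.+1], whence [i < k]. *)
Lemma reflect_prefix_bound s d i k :
  size (sel i (unzip1 s)) + d < size (sel i.+1 (unzip2 s)) ->
  all (leq^~ k) (sel i (unzip1 s)) -> all (leq^~ k) (sel i.+1 (unzip2 s)) ->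
  all (leq^~ k) (sel i (unzip1 (reflect_prefix d s))) /\
  all (leq^~ k) (sel i.+1 (unzip2 (reflect_prefix d s))).
Proof.
move=> + + hb; move=> /[dup] /excess_bound - /(_ _ hb) ik.
elim: s d i hb ik => //= -[a b] t IH e i.
rewrite /= !sel_cons !all_cat => /andP[hb hbt] ik h /andP[ha hat].
have hb' : all (leq^~ k) (nseq b i) by case: (b) => //=; rewrite andbT ltnW.
have ha' : all (leq^~ k) (nseq a i.+1) by case: (a) => //=; rewrite andbT.
case: ifP => stop; first by rewrite hb' ha' hat hbt.
have ht : size (sel i.+1 (unzip1 t)) + (e + a - b) < size (sel i.+2 (unzip2 t)).
  move: h stop; rewrite !size_cat !size_nseq.
  by case: a b {ha ha' hb hb'} => [] [] /=; lia.
rewrite hb' ha' /=; apply: IH => //.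
exact: excess_bound ht hbt.
Qed.

(** * Sequences as pairs of sets *)

(* (b, s) encodes b = [1 \in B] and s_i = ([i \in A], [i.+1 \in B]) for
   1 <= i <= n. *)
Notation config n := (bool * n.-tuple (bool * bool))%type.

Definition rises n (x : config n) := sel 1 (unzip1 x.2).
Definition falls n (x : config n) := sel 1 (x.1 :: unzip2 x.2).

Lemma falls_cons n b (s : n.-tuple (bool * bool)) :
  falls (b, s) = nseq b 1 ++ sel 2 (unzip2 s).
Proof. exact: sel_cons. Qed.

Definition config_of n (a b : seq nat) : config n :=
  (1 \in b, map_tuple (fun i => (i \in a, i.+1 \in b)) (iota_tuple n 1)).

Lemma config_ofK n a b : sorted ltn a -> sorted ltn b ->
  all (fun x => 0 < x <= n) a -> all (fun x => 0 < x <= n) b ->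
  rises (config_of n a b) = a /\ falls (config_of n a b) = b.
Proof.
move=> sa sb ha hb; split.
  rewrite /rises /= /unzip1 -map_comp sel_mem //.
rewrite /falls /= /unzip2 -map_comp.
rewrite -[RHS](@sel_mem 1 n.+1) //=; last first.
  by apply: sub_all hb => x; lia.
by rewrite (iotaDl 1 1) -map_comp.
Qed.

Lemma config_inj n (x y : config n) :
  rises x = rises y -> falls x = falls y -> x = y.
Proof.
case: x y => [b s] [c t]; rewrite /rises /falls /=.
move=> /sel_inj; rewrite !size_map !size_tuple => /(_ erefl) h1.
move=> /sel_inj; rewrite /= !size_map !size_tuple => /(_ erefl) [-> h2].
congr pair; apply: val_inj => /=.
by rewrite -(zip_unzip s) -(zip_unzip t) h1 h2.
Qed.

(** The weight determines the peak, and this is the largest value that it leaves to the other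
    terms. *)
Definition pre_peak n (x : config n) :=
  (n - (sumn (rises x) + sumn (falls x))).-1.

Definition valid m n (x : config n) :=
  [&& size (falls x) == size (rises x) + m,
      sumn (rises x) + sumn (falls x) < n,
      all (leq^~ (pre_peak x)) (rises x) & all (leq^~ (pre_peak x)) (falls x)].

Definition to_seq n (x : config n) :=
  rises x ++ (pre_peak x).+1 :: rev (falls x).

Lemma to_seq_peak m n (x : config n) : valid m x ->
  is_peak (to_seq x) (size (rises x)).+1.
Proof.
case/and4P=> _ _ hA hB; apply/and3P; split.
- by rewrite size_cat /= addnS ltnS leq_addr.
- rewrite /to_seq -cat_rcons take_size_cat ?size_rcons //.
  rewrite -cats1; case E: (rises x) => [|a r] //=.
  move: (sorted_sel 1 (unzip1 x.2)); rewrite -/(rises x) E /= cat_path => -> /=.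
  rewrite andbT ltnS; apply: (allP hA); rewrite E; exact: mem_last.
- rewrite /to_seq /= drop_size_cat //= path_sortedE; last first.
    by move=> a b c /= h1 h2; apply: ltn_trans h2 h1.
  rewrite all_rev rev_sorted sorted_sel andbT.
  by apply: sub_all hB => y; rewrite /= ltnS.
Qed.

Lemma to_seq_su m n (x : config n) : valid m x -> su_pred m n (to_seq x).
Proof.
move=> v; have pk := to_seq_peak v; case/and4P: v => /eqP hs hn hA hB.
apply/and3P; split.
- apply/andP; split.
    rewrite all_cat /= all_rev; apply/andP; split; apply/allP => y /sel_ge //.
  apply/hasP; exists (size (rises x)).+1 => //; rewrite mem_iota.
  by rewrite add1n ltnS; case/and3P: pk.
- rewrite sumn_cat /= sumn_rev /pre_peak; lia.
- by rewrite (rankE pk) /to_seq size_cat /= size_rev hs; apply/eqP; lia.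
Qed.

(** Uniqueness of the peak position tells where to cut the sequence. *)
Lemma to_seq_inj m n : {in valid m (n := n) &, injective (@to_seq n)}.
Proof.
move=> x y vx vy e.
have := is_peak_uniq (to_seq_peak vx); rewrite e => /(_ _ (to_seq_peak vy)) [sz].
move/eqP: e; rewrite /to_seq eqseq_cat // => /andP[/eqP hr].
rewrite /= eqseq_cons => /andP[_ /eqP /(can_inj revK) hf].
exact: config_inj.
Qed.

Lemma mem_leq_sumn (s : seq nat) x : x \in s -> x <= sumn s.
Proof. by elim: s => //= y s IH; rewrite inE => /orP[/eqP->|/IH]; lia. Qed.

Lemma to_seq_surj (m n : nat) s : su_pred m n s ->
  exists2 x : config n, valid m x & to_seq x = s.
Proof.
case/and3P => /andP[pos /hasP[k _ pk]] /eqP sn rk.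
move: rk; rewrite (rankE pk); case/and3P: pk => /andP[k0 ks] inc dec /eqP rk.
set p := nth 0 s k.-1; set a := take k.-1 s; set b := drop k s.
have sE : s = a ++ p :: b.
  by rewrite -[LHS](cat_take_drop k.-1) (drop_nth 0) ?prednK // -ltnS prednK.
have tE : take k s = rcons a p by rewrite -{1}(prednK k0) (take_nth 0) ?prednK.
have dE : drop k.-1 s = p :: b by rewrite (drop_nth 0) ?prednK.
move: inc; rewrite tE => inc; move: dec; rewrite dE /= path_sortedE; last first.
  by move=> ? ? ? /= h1 h2; apply: ltn_trans h2 h1.
case/andP => bp sb.
have /andP[sa ap] : sorted ltn a && all (ltn^~ p) a.
  (* Reversal puts [p] at the head, where [path_sortedE] compares it with every term of [a]. *)
  move: inc; rewrite -rev_sorted rev_rcons /= path_sortedE; last first.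
    by move=> ? ? ? /= h1 h2; apply: ltn_trans h2 h1.
  by rewrite rev_sorted all_rev andbC.
have pos_s y : y \in s -> 0 < y by move/(allP pos).
have le_s y : y \in s -> y <= n by rewrite -sn; apply: mem_leq_sumn.
have bnd (t : seq nat) : {subset t <= s} -> all (fun y => 0 < y <= n) t.
  by move=> ts; apply/allP => y /ts ys; rewrite pos_s ?le_s.
have p0 : 0 < p by apply: pos_s; rewrite mem_nth // prednK.
have [rA rB] : rises (config_of n a (rev b)) = a /\
               falls (config_of n a (rev b)) = rev b.
  apply: config_ofK; rewrite ?rev_sorted //; apply: bnd => y.
    exact: mem_take.
  by rewrite mem_rev; apply: mem_drop.
have nE : n = sumn a + p + sumn b by rewrite -sn sE sumn_cat /= addnA.
have pE : (pre_peak (config_of n a (rev b))).+1 = p.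
  rewrite /pre_peak rA rB sumn_rev; lia.
exists (config_of n a (rev b)); last by rewrite /to_seq pE rA rB revK.
have lt_pp y : (y <= pre_peak (config_of n a (rev b))) = (y < p) by rewrite -pE.
rewrite /valid rA rB size_rev sumn_rev all_rev; apply/and4P; split.
- move: rk; rewrite size_take size_drop; case: ltnP; lia.
- lia.
- by rewrite (eq_all (a2 := ltn^~ p)).
- by rewrite (eq_all (a2 := ltn^~ p)).
Qed.

Lemma u_valid (m n : nat) : u m n = #|[set x : config n | valid m x]|.
Proof.
rewrite (@uE _ _ [seq to_seq x | x <- enum [set x : config n | valid m x]]).
- by rewrite size_map cardE.
- rewrite map_inj_in_uniq ?enum_uniq // => x y.
  by rewrite !mem_enum !inE; apply: to_seq_inj.
move=> s; apply/mapP/idP => [[x]|/to_seq_surj[x vx <-]].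
  by rewrite mem_enum inE => vx ->; apply: to_seq_su.
by exists x => //; rewrite mem_enum inE.
Qed.

(** * The injection from rank [m.+1] to rank [m] *)

Lemma reflect_prefix_tupleP n (s : n.-tuple (bool * bool)) :
  size (reflect_prefix 0 s) == n.
Proof. by rewrite size_reflect_prefix size_tuple. Qed.

Definition lower n (x : config n) : config n :=
  if x.1 then (false, x.2) else (true, Tuple (reflect_prefix_tupleP x.2)).

Lemma lower_inj n : injective (@lower n).
Proof.
move=> [[] s] [[] t]; rewrite /lower //= => -[]; first by move=> ->.
by move=> /reflect_prefix_inj /val_inj ->.
Qed.

Lemma lower_valid m n (x : config n) : valid m.+1 x -> valid m (lower x).
Proof.
rewrite /valid /pre_peak; case: x => -[] s; rewrite /lower !falls_cons /rises /=.
  move=> /and4P[/eqP hs hn hA hB].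
  (* Without the term 1 the peak is larger, so the old bounds suffice. *)
  have le_k y : y <= (n - (sumn (sel 1 (unzip1 s)) +
      (1 + sumn (sel 2 (unzip2 s))))).-1 ->
    y <= (n - (sumn (sel 1 (unzip1 s)) + sumn (sel 2 (unzip2 s)))).-1 by lia.
  apply/and4P; split; [lia | lia | exact: sub_all hA | ].
  by case/andP: hB => _; apply: sub_all.
move=> /and4P[/eqP hs hn hA hB].
have ex : size (sel 1 (unzip1 s)) + 0 < size (sel 2 (unzip2 s)) by lia.
have [hs1 hs2] := size_reflect_prefix_sel ex.
have hsum := sumn_reflect_prefix ex.
have [hA' hB'] := reflect_prefix_bound ex hA hB.
(* This leaves room for the new term 1 below the peak. *)
have k1 := excess_bound ex hB.
set k := _.-1 in hA hB hA' hB' k1.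
(* The new term 1 makes up for the sum lost in the exchange: the peak is unchanged. *)
have -> : (n - (sumn (sel 1 (unzip1 (reflect_prefix 0 s))) +
  (1 + sumn (sel 2 (unzip2 (reflect_prefix 0 s)))))).-1 = k by rewrite /k; lia.
by apply/and4P; split; [lia | lia | | rewrite (ltnW k1)].
Qed.

Lemma u_noninc m n : u m.+1 n <= u m n.
Proof.
rewrite !u_valid -(card_imset _ (@lower_inj n)); apply/subset_leq_card.
apply/subsetP => _ /imsetP[x + ->]; rewrite !inE; exact: lower_valid.
Qed.

(** * Strictness *)

Lemma u_lt m n (x : config n) : valid m x ->
  (forall y : config n, valid m.+1 y -> lower y <> x) -> u m.+1 n < u m n.
Proof.
move=> vx nx; rewrite !u_valid -(card_imset _ (@lower_inj n)).
apply/proper_card/properP; split.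
  by apply/subsetP => _ /imsetP[y + ->]; rewrite !inE; apply: lower_valid.
exists x; rewrite ?inE //; apply/imsetP => -[y]; rewrite inE => vy e.
exact: (nx y).
Qed.

(** The image contains 1 in [falls] only after an exchange, which gives [rises] one more element. *)
Lemma lower_rises m n (y : config n) :
  valid m.+1 y -> (lower y).1 -> 0 < size (rises (lower y)).
Proof.
case: y => -[] s //; rewrite /valid /lower !falls_cons /rises /=.
case/and4P => /eqP hs _ _ _ _.
have ex : size (sel 1 (unzip1 s)) + 0 < size (sel 2 (unzip2 s)) by lia.
by have [-> _] := size_reflect_prefix_sel ex; rewrite addn1.
Qed.

(** Here a term 1 was removed: the old peak, one smaller, still bounds [falls] strictly. *)
Lemma lower_gap m n (y : config n) :
  valid m.+1 y -> ~~ (lower y).1 ->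
  pre_peak (lower y) \notin falls (lower y).
Proof.
case: y => -[] s //; rewrite /valid /pre_peak /lower !falls_cons /rises /=.
move=> /and4P[_ hn _ /andP[_ hB]] _.
apply/negP => /(allP hB); lia.
Qed.

(** The sequence missed by [lower] is a peak followed by [m.+1], ..., 1. Its peak must be at least
    [m.+2], so its weight is at least 1 + ... + [m.+2], which is the binomial. *)
Lemma u_lt_pos m n : 'C(m.+3, 2) <= n -> u m.+2 n < u m.+1 n.
Proof.
move=> hn.
have sumE : m.+2 + sumn (iota 1 m.+1) = 'C(m.+3, 2).
  rewrite -bin2_sum -[sumn _]/(sumn (iota 0 m.+2)) sumnE.
  by rewrite big_nat_recr //= addnC.
have [hA hB] : rises (config_of n [::] (iota 1 m.+1)) = [::] /\
               falls (config_of n [::] (iota 1 m.+1)) = iota 1 m.+1.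
  apply: config_ofK => //; first exact: iota_ltn_sorted.
  by apply/allP => y; rewrite mem_iota; lia.
apply: (@u_lt _ _ (config_of n [::] (iota 1 m.+1))).
  rewrite /valid /pre_peak hA hB size_iota; apply/and4P; split=> //.
    by rewrite [sumn [::]]/=; lia.
  by apply/allP => y; rewrite mem_iota [sumn [::]]/=; lia.
by move=> y vy ey; have := lower_rises vy; rewrite ey hA => /(_ isT).
Qed.

(** In rank 0 an empty [rises] forces an empty [falls], so [lower_gap] is used instead, on the
    sequence [e.+1], [p], [p.-1], where [e] absorbs the parity of [n]. From [6 <= n] comes [3 <= p],
    so that [p.-1] is not 1 and [e.+1 < p]. *)
Lemma u_lt_zero n : 6 <= n -> u 1 n < u 0 n.
Proof.
move=> hn; set p := n./2; set e := odd n : nat.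
have nE : n = e + p.*2 by rewrite odd_double_half.
have e1 : e <= 1 by rewrite /e; case: odd.
have [hA hB] : rises (config_of n [:: e.+1] [:: p.-1]) = [:: e.+1] /\
               falls (config_of n [:: e.+1] [:: p.-1]) = [:: p.-1].
  apply: config_ofK => //=; lia.
apply: (@u_lt _ _ (config_of n [:: e.+1] [:: p.-1])).
  rewrite /valid /pre_peak hA hB /=; lia.
move=> y vy ey; have := lower_gap vy.
rewrite ey /pre_peak hA hB /= !inE; lia.
Qed.

Theorem theorem1p3 :
  (forall m n : nat, u (Posz m.+1) n <= u (Posz m) n) /\
  (forall m n : nat, maxn 6 'C(m.+2, 2) <= n ->
     u (Posz m.+1) n < u (Posz m) n).
Proof.
split=> [|m n]; first exact: u_noninc.
rewrite geq_max => /andP[n6]; case: m => [_|m]; first exact: u_lt_zero.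
exact: u_lt_pos.
Qed.
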